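(* For every real $p\in(0,1)$ and every positive integer $n$, $$\operatorname{wdisc}^{\max}_p(n)\ \ge\ \frac{\sqrt{n-1}}{16}.$$
   Context: $\mathbb{N}$ denotes the positive integers and $\mathbf{1}$ the all-ones vector in $\mathbb{R}^m$. For $p\in[0,1]$ and a matrix $\mathbf{A}\in[0,1]^{n\times m}$, the $p$-weighted discrepancy of $\mathbf{A}$ is $$\operatorname{wdisc}_p(\mathbf{A}) := \min_{\mathbf{x}\in\{0,1\}^m}\|\mathbf{A}(p\cdot\mathbf{1}-\mathbf{x})\|_\infty.$$ Define $\operatorname{wdisc}^{\max}_p(n) := \sup_{m\in\mathbb{N}}\ \sup_{\mathbf{A}\in[0,1]^{n\times m}}\operatorname{wdisc}_p(\mathbf{A})$. *)

(* Defs.v *)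
From mathcomp Require Import all_boot all_order all_algebra.
From mathcomp Require Import all_classical all_reals all_analysis.

Set Implicit Arguments.
Unset Strict Implicit.
Unset Printing Implicit Defensive.

Import Order.TTheory GRing.Theory Num.Theory.
Import numFieldNormedType.Exports.

Local Open Scope classical_set_scope.
Local Open Scope ring_scope.

(* The norm of MathComp-Analysis on matrices is the maximum of the absolute
   values of the entries, hence the sup norm on column vectors. *)
Definition rounding_err (R : realType) (p : R) (n m : nat) (A : 'M[R]_(n, m))
    (x : 'cV[bool]_m) : R :=
  `| A *m (p *: const_mx 1 - map_mx (fun b : bool => b%:R) x) |.

(* [const_mx false] only witnesses that the finite type of 0/1 vectors is
   nonempty; the value is the minimum over all of them. *)
Definition wdisc (R : realType) (p : R) (n m : nat) (A : 'M[R]_(n, m)) : R :=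
  rounding_err p A
    [arg min_(x < (const_mx false : 'cV[bool]_m)) rounding_err p A x]%O.

(* The suprema are taken in the extended reals, so that no boundedness is
   presupposed. *)
Definition wdiscmax (R : realType) (p : R) (n : nat) : \bar R :=
  ereal_sup
    [set ereal_sup
           [set (wdisc p A)%:E
             | A in [set A : 'M[R]_(n, m) | forall i j, 0 <= A i j <= 1]]
      | m in [set m : nat | (0 < m)%N]].

(* Main.v *)
Require Import Defs.
From mathcomp Require Import all_boot all_order all_algebra.
From mathcomp Require Import all_classical all_reals all_analysis.
From mathcomp Require Import ring lra.

Import Order.TTheory GRing.Theory Num.Theory.
Import numFieldNormedType.Exports.
Local Open Scope ring_scope.

(** Choose c such that p c is at distance at least 1/3 from every integer, and
repeat each column of the 0/1 matrix (H + J) / 2 exactly c times, where H is a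
Sylvester-Hadamard matrix of order N = 2^k with N <= n < 2 N, and J is all ones.
The product with p 1 - x is (H z + (sum z) 1) / 2 where all |z_j| >= 1/3.  As H
has an all-ones row, |sum z| <= D for D the rounding error, hence every entry of
H z is at most 3 D, while |H z|_2^2 = N |z|_2^2 >= N^2 / 9. Thus
D >= sqrt N / 9. *)

(** The order doubles as a sum because this is the size that [block_mx] produces, so [sylvester]
    typechecks without casts. *)
Fixpoint sylvester_order (k : nat) : nat :=
  if k is k'.+1 then (sylvester_order k' + sylvester_order k')%N else 1%N.

Lemma sylvester_orderE k : sylvester_order k = (2 ^ k)%N.
Proof. by elim: k => //= k ->; rewrite expnS mul2n addnn. Qed.

Fixpoint sylvester (R : nzRingType) (k : nat) : 'M[R]_(sylvester_order k) :=
  if k is k'.+1 then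
    block_mx (sylvester R k') (sylvester R k')
             (sylvester R k') (- sylvester R k')
  else 1%:M.

Section Sylvester.
Variable R : comNzRingType.

Lemma sylvester_orthogonal k :
  (sylvester R k)^T *m sylvester R k = (sylvester_order k)%:R%:M.
Proof.
elim: k => [|k IH] /=; first by rewrite trmx1 mulmx1.
rewrite tr_block_mx mulmx_block !linearN /= !mulNmx opprK IH subrr.
by rewrite -raddfD -natrD -scalar_mx_block.
Qed.

Lemma sylvester_sign k i j : sylvester R k i j = 1 \/ sylvester R k i j = -1.
Proof.
elim: k i j => [|k IH] i j /=; first by rewrite !ord1 mxE; left.
rewrite -(splitK i) -(splitK j).
case: (fintype.split i) => a; case: (fintype.split j) => b /=;
  rewrite ?block_mxEul ?block_mxEur ?block_mxEdl ?block_mxEdr //.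
by rewrite mxE; case: (IH a b) => ->; rewrite ?opprK; [right|left].
Qed.

(** This row makes the sum of the entries of z itself an entry of (H + J) z / 2, so the shift by J
    can be removed. *)
Lemma sylvester_row1 k : exists i, forall j, sylvester R k i j = 1.
Proof.
elim: k => [|k [i Hi]] /=; first by exists ord0 => j; rewrite !ord1 mxE.
exists (lshift _ i) => j; rewrite -(splitK j).
by case: (fintype.split j) => b /=; rewrite ?block_mxEul ?block_mxEur.
Qed.

Lemma sylvester_sqr_norm k (z : 'cV[R]_(sylvester_order k)) :
  \sum_i (sylvester R k *m z) i 0 ^+ 2 =
  (sylvester_order k)%:R * \sum_j z j 0 ^+ 2.
Proof.
have dotE m (v : 'cV[R]_m) : (v^T *m v) 0 0 = \sum_i v i 0 ^+ 2.
  by rewrite mxE; apply: eq_bigr => i _; rewrite mxE expr2.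
rewrite -!dotE trmx_mul mulmxA -(mulmxA z^T) sylvester_orthogonal.
by rewrite mul_mx_scalar -scalemxAl mxE.
Qed.

End Sylvester.

Section Rounding.
Variable R : realType.

Lemma half_sylvester_lower_bound k (z : 'cV[R]_(sylvester_order k)) (D : R) :
  (forall j, 1 / 3 <= `|z j 0|) ->
  (forall i, `|\sum_j (sylvester R k i j + 1) / 2 * z j 0| <= D) ->
  (sylvester_order k)%:R <= 81 * D ^+ 2.
Proof.
set N := sylvester_order k; move=> z_ge hD.
set a := fun i => \sum_j (sylvester R k i j + 1) / 2 * z j 0.
have [i0 row1] := sylvester_row1 R k.
have N_gt0 : 0 < N%:R :> R by rewrite ltr0n /N sylvester_orderE expn_gt0.
(* Row [i0] of (H + J) / 2 is all ones, so [a i0] is the sum of the entries of [z]. *)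
have HzE i : (sylvester R k *m z) i 0 = 2 * a i - a i0.
  rewrite mxE /a mulr_sumr -sumrB; apply: eq_bigr => j _.
  by rewrite row1; field.
have Hz_le i : (sylvester R k *m z) i 0 ^+ 2 <= 9 * D ^+ 2.
  have := hD i; have := hD i0; rewrite HzE -/(a i) -/(a i0) !ler_norml.
  by move=> /andP[h1 h2] /andP[h3 h4]; nra.
have ub : \sum_i (sylvester R k *m z) i 0 ^+ 2 <= N%:R * (9 * D ^+ 2).
  apply: le_trans (ler_sum _ (fun i _ => Hz_le i)) _.
  by rewrite sumr_const card_ord (mulr_natl _ N).
have lb : N%:R * (1 / 9) <= \sum_j z j 0 ^+ 2.
  rewrite mulr_natl -[N in _ *+ N]card_ord -sumr_const.
  apply: ler_sum => j _; rewrite -(real_normK (num_real (z j 0))).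
  by have := z_ge j; nra.
move: ub; rewrite sylvester_sqr_norm ler_pM2l // => ub.
by lra.
Qed.

(** The first multiple of [q] to reach 1/3 is at most 2/3: steps of length at most 1/3 cannot jump
    over [1/3, 2/3], and a larger [q] already lies in it. Points of this interval are at distance at
    least 1/3 from every integer. *)
Lemma exists_multiple_far_from_int_half (q : R) : 0 < q <= 1 / 2 ->
  exists2 c : nat, (0 < c)%N & forall y : int, 1 / 3 <= `|q * c%:R - y%:~R|.
Proof.
move=> /andP[q0 q2].
have ex : exists c : nat, 1 / 3 <= q * c%:R.
  exists (Num.bound (1 / q)); rewrite [q * _]mulrC -ler_pdivrMr //.
  apply: ltW; apply: le_lt_trans (archi_boundP _).
    by rewrite ler_pM2r ?invr_gt0 //; lra.
  by rewrite divr_ge0 // ltW.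
case: (ex_minnP ex) => c c_ge c_min.
have c_gt0 : (0 < c)%N by case: (c) c_ge => //; rewrite mulr0; lra.
have c_le : q * c%:R <= 2 / 3.
  rewrite leNgt; apply/negP => c_gt.
  (* Beyond 2/3, the previous multiple would already reach 1/3, against minimality. *)
  have : (c <= c.-1)%N.
    apply: c_min; rewrite -subn1 natrB //.
    have [q3|q3] := lerP q (1 / 3); first by lra.
    case: c c_gt0 {c_ge} c_gt => [|[|c]] // _; first by lra.
    have c_ge0 : 0 <= c%:R :> R by [].
    by rewrite -[c.+2]addn2 natrD; nra.
  by rewrite leqNgt prednK // leqnn.
exists c => // y; rewrite ler_normr; case: (lerP y 0) => hy.
  have : y%:~R <= 0 :> R by rewrite lerz0.
  by move=> hy'; apply/orP; left; lra.
have : 1 <= y%:~R :> R by rewrite ler1z.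
by move=> hy'; apply/orP; right; lra.
Qed.

(** The numbers p c and (1 - p) c add up to the integer c, so they are equally far from the
    integers; this reduces p > 1/2 to 1 - p. *)
Lemma exists_multiple_far_from_int (p : R) : 0 < p < 1 ->
  exists2 c : nat, (0 < c)%N & forall y : int, 1 / 3 <= `|p * c%:R - y%:~R|.
Proof.
move=> /andP[p0 p1]; case: (lerP p (1 / 2)) => hp.
  by apply: exists_multiple_far_from_int_half; rewrite p0.
have [|c c_gt0 hc] := @exists_multiple_far_from_int_half (1 - p).
  by apply/andP; split; lra.
exists c => // y; rewrite -normrN.
have -> : - (p * c%:R - y%:~R) = (1 - p) * c%:R - (c%:Z - y)%:~R.
  by rewrite intrB -pmulrn; ring.
exact: hc.
Qed.

Lemma ler_mx_norm_entry n m (A : 'M[R]_(n, m)) i j : `|A i j| <= `|A|.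
Proof.
rewrite [leRHS]mx_normrE.
exact: (le_bigmax _ (fun ij : 'I_n * 'I_m => `|A ij.1 ij.2|) (i, j)).
Qed.

(** [wdisc] is the error at one particular vector, the minimiser, so the hypothesis specialises to
    it. *)
Lemma wdisc_lower_bound (p : R) n m (A : 'M[R]_(n, m)) (b : R) :
  (forall x, b <= rounding_err p A x) -> b <= wdisc p A.
Proof. exact. Qed.

Lemma wdisc_le_wdiscmax (p : R) n m (A : 'M[R]_(n, m)) : (0 < m)%N ->
  (forall i j, 0 <= A i j <= 1) -> ((wdisc p A)%:E <= wdiscmax p n)%E.
Proof.
move=> m_gt0 hA; apply: le_trans; last first.
  by apply: ereal_sup_ubound; exists m.
by apply: ereal_sup_ubound; exists A.
Qed.

(* A column index encodes a pair (column of H, number of the copy); [g] pads to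
   [n] rows by repeating rows. *)
Lemma rounding_err_repeat_lower_bound (p : R) (k n c : nat)
    (g : 'I_n -> 'I_(sylvester_order k)) (h : 'I_(sylvester_order k) -> 'I_n)
    (x : 'cV[bool]_#|{: 'I_(sylvester_order k) * 'I_c}|) :
  cancel h g -> (forall y : int, 1 / 3 <= `|p * c%:R - y%:~R|) ->
  (sylvester_order k)%:R <= 81 * (rounding_err p (\matrix_(i, l)
    ((sylvester R k (g i) (enum_val l).1 + 1) / 2)) x) ^+ 2.
Proof.
move=> hK hc.
(* [y j] counts the copies of column [j] rounded to 1; together the [c] copies contribute that
   column times p c - [y j]. *)
pose y j := (\sum_(t < c) x (enum_rank (j, t)) 0%R)%N.
apply: (@half_sylvester_lower_bound k (\col_j (p * c%:R - (y j)%:R))).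
  by move=> j; rewrite mxE; have := hc (y j); rewrite -pmulrn.
move=> i; rewrite /rounding_err.
(* By [hK], row [h i] of the padded matrix carries row [i] of (H + J) / 2. *)
apply: le_trans (ler_mx_norm_entry _ _ _ (h i) 0).
rewrite le_eqVlt; apply/orP; left; apply/eqP; congr (`|_|).
rewrite mxE (reindex (@enum_rank {: 'I_(sylvester_order k) * 'I_c})) /=; last first.
  by exists enum_val => u _; rewrite ?enum_rankK ?enum_valK.
transitivity (\sum_(u : 'I_(sylvester_order k) * 'I_c)
    (sylvester R k i u.1 + 1) / 2 * (p - (x (enum_rank (u.1, u.2)) 0)%:R)).
  rewrite -(pair_bigA _ (fun j t => (sylvester R k i j + 1) / 2 *
    (p - (x (enum_rank (j, t)) 0)%:R))) /=.
  apply: eq_bigr => j _; rewrite mxE -mulr_sumr; congr (_ * _).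
  by rewrite sumrB sumr_const card_ord mulr_natr natr_sum.
by apply: eq_bigr => -[j t] _; rewrite !mxE enum_rankK hK mulr1.
Qed.

End Rounding.

Theorem theorem3p2 (R : realType) (p : R) (hp : 0 < p < 1)
    (n : nat) (hn : (0 < n)%N) :
  ((Num.sqrt (n%:R - 1) / 16)%:E <= wdiscmax p n)%E.
Proof.
have [c c_gt0 hc] := exists_multiple_far_from_int R p hp.
pose k := trunc_log 2 n; pose N := sylvester_order k.
have NE : N = (2 ^ k)%N := sylvester_orderE k.
have N_gt0 : (0 < N)%N by rewrite NE expn_gt0.
have N_le : (N <= n)%N by rewrite NE trunc_logP.
have n_lt : (n < 2 * N)%N by rewrite NE -expnS trunc_log_ltn.
(* Rows of index at least [N] all repeat row 0, the default of [insubd]. *)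
pose g (i : 'I_n) : 'I_N := insubd (Ordinal N_gt0) (i : nat).
have hK : cancel (widen_ord N_le) g by move=> i; rewrite /g /= valKd.
pose A : 'M[R]_(n, #|{: 'I_N * 'I_c}|) :=
  \matrix_(i, l) ((sylvester R k (g i) (enum_val l).1 + 1) / 2).
apply: le_trans (@wdisc_le_wdiscmax R p n _ A _ _); first last.
- move=> i l; rewrite mxE.
  by case: (sylvester_sign R k (g i) (enum_val l).1) => ->; apply/andP; split; lra.
- by rewrite card_prod !card_ord muln_gt0 N_gt0.
rewrite lee_fin; apply: wdisc_lower_bound => x.
have := @rounding_err_repeat_lower_bound R p k n c g _ x hK hc.
rewrite -/A -/N; set D := rounding_err p A x => hD.
have D_ge0 : 0 <= D by exact: normr_ge0.
have n_le : n%:R <= 2 * N%:R :> R by rewrite -natrM ler_nat ltnW.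
(* The constant 16 leaves slack: n <= 2 N <= 162 D^2 <= (16 D)^2. *)
rewrite ler_pdivrMr // -[D * 16]ger0_norm ?mulr_ge0 // -sqrtr_sqr.
by apply: ler_wsqrtr; nra.
Qed.
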